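(* Let $\theta=(N-k,1,\ldots,1)\vdash N$ be a hook-shape partition and let $\mu/\nu$ be a skew shape with $|\mu/\nu|=N$. Then the immanant character $\Gamma^{\theta}_{\mu/\nu}$ is a non-negative integer sum of Stanley-Stembridge characters.
   Context: Partitions are weakly decreasing sequences of positive integers, extended by zeros when needed ($\nu$ may be empty). A skew shape $\mu/\nu$ is a pair of partitions with $\nu_i\le\mu_i$ for all $i$; its length $\ell(\mu/\nu)$ is the largest $i$ with $\nu_i<\mu_i$, and $|\mu/\nu|=\sum_i(\mu_i-\nu_i)$. A hook-shape partition of $N$ is $\theta=(N-k,1,\ldots,1)$ with $k$ ones after the first part, $0\le k\le N-1$. For $\theta\vdash N$ and an integer sequence $c=(c_1,\ldots,c_n)$ summing to $N$, the Kostka number $K_{\theta,c}$ is the number of semistandard Young tableaux of shape $\theta$ with content $c$ (i.e. $c_i$ entries equal to $i$); it is $0$ if some $c_i<0$. Fix $n\ge\ell(\mu/\nu)$ and let $\delta=(n-1,\ldots,1,0)$. Regard $\mu,\nu$ as their first $n$ entries, and let $w\in S_n$ act on sequences by $w(a_1,\ldots,a_n)=(a_{w^{-1}(1)},\ldots,a_{w^{-1}(n)})$. For $\theta\vdash N=|\mu/\nu|$ the immanant character $\Gamma^\theta_{\mu/\nu}:S_n\to\mathbb{Z}$ is $$\Gamma^\theta_{\mu/\nu}(w)=\frac{n!}{|C(w)|}\sum_{w'\in C(w)}K_{\theta,\ \mu+\delta-w'(\nu+\delta)},$$ where $C(w)$ is the conjugacy class of $w$ in $S_n$. A Stanley-Stembridge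 character of $S_n$ is an immanant character $\Gamma^{(M)}_{\alpha/\beta}$ of $S_n$, where $\alpha/\beta$ is a skew shape with $\ell(\alpha/\beta)\le n$ and $M=|\alpha/\beta|$ ($M$ may vary among the summands), and $(M)$ is the one-row partition. *)

(* Defs.v *)
From mathcomp Require Import all_boot all_order all_algebra all_fingroup.

Set Implicit Arguments.
Unset Strict Implicit.
Unset Printing Implicit Defensive.

Import GRing.Theory.

Local Open Scope nat_scope.

(* The parts of a partition p are indexed from 0: part p i is the (i+1)-st
   part, and it is 0 beyond the last positive part. *)
Definition is_partition (p : seq nat) : bool := sorted geq p && (0 \notin p).

Definition part (p : seq nat) (i : nat) : nat := nth 0 p i.

Definition is_skew_shape (mu nu : seq nat) : Prop :=
  [/\ is_partition mu, is_partition nu & forall i, part nu i <= part mu i].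

(* When nu is contained in mu, all i with part nu i < part mu i are below
   size mu. The index is shifted so that the length is the largest 1-based row
   index of a nonempty row, and it is 0 if mu = nu. *)
Definition skew_length (mu nu : seq nat) : nat :=
  \max_(i < size mu | part nu i < part mu i) i.+1.

Definition skew_size (mu nu : seq nat) : nat :=
  \sum_(i < size mu) (part mu i - part nu i).

Definition hook (N k : nat) : seq nat := (N - k) :: nseq k 1.

(* For M = 0 this is the empty shape, written with one zero part. *)
Definition one_row (M : nat) : seq nat := [:: M].

(* The cells of the Young diagram of theta, as pairs (row, column). *)
Definition cell (theta : seq nat) : finType :=
  {r : 'I_(size theta) & 'I_(part theta r)}.

Definition cell_row (theta : seq nat) (x : cell theta) : nat := tag x.
Definition cell_col (theta : seq nat) (x : cell theta) : nat := tagged x.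

(* Entries 1, ..., n are represented by 'I_n. *)
Definition semistandard (n : nat) (theta : seq nat)
    (T : {ffun cell theta -> 'I_n}) : bool :=
  [forall x, forall y,
    ((cell_row x == cell_row y) && (cell_col x <= cell_col y) ==> (T x <= T y))
    &&
    ((cell_col x == cell_col y) && (cell_row x < cell_row y) ==> (T x < T y))].

Definition has_content (n : nat) (theta : seq nat)
    (T : {ffun cell theta -> 'I_n}) (c : 'I_n -> int) : bool :=
  [forall i, Posz #|[set x | T x == i]| == c i].

Definition kostka (n : nat) (theta : seq nat) (c : 'I_n -> int) : nat :=
  #|[set T : {ffun cell theta -> 'I_n} | semistandard T && has_content T c]|.

Local Open Scope ring_scope.

Definition seq_act (n : nat) (w : 'S_n) (a : 'I_n -> int) : 'I_n -> int :=
  fun i => a ((w^-1)%g i).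

(* The first n entries of p + delta, where delta = (n-1, ..., 1, 0). *)
Definition shifted (n : nat) (p : seq nat) : 'I_n -> int :=
  fun i => Posz (part p i) + Posz (n - i.+1)%N.

(* The Euclidean quotient below is exact by card_classS_dvd. *)
Definition immanant_char (n : nat) (theta mu nu : seq nat)
    : {ffun 'S_n -> int} :=
  [ffun w : 'S_n =>
    Posz (n`! %/ #|(w ^: [set: 'S_n])%g|)%N *
    \sum_(w' in (w ^: [set: 'S_n])%g)
      Posz (kostka theta
        (fun i => shifted mu i - seq_act w' (shifted nu) i))].

Lemma card_classS_dvd (n : nat) (w : 'S_n) :
  (#|(w ^: [set: 'S_n])%g| %| n`!)%N.
Proof.
by rewrite -index_cent1 -[X in (_ %| X)%N](card_Sn n) -cardsT dvdn_indexg.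
Qed.

Definition Stanley_Stembridge_char (n : nat) (chi : {ffun 'S_n -> int}) : Prop :=
  exists alpha beta : seq nat,
    [/\ is_skew_shape alpha beta, (skew_length alpha beta <= n)%N
      & chi = immanant_char n (one_row (skew_size alpha beta)) alpha beta].

(* Main.v *)
Require Import Defs.
From mathcomp Require Import all_boot all_order all_algebra all_fingroup.
From mathcomp Require Import zify.

Import GRing.Theory.

Local Open Scope ring_scope.

Set Implicit Arguments.
Unset Strict Implicit.
Unset Printing Implicit Defensive.

(** Put a = mu + delta, b = nu + delta, and for w in S_n let c be the content
    a - w b, so that c_i = a_i - b_(w^-1 i).

    A tableau of shape (N - k, 1^k) and content c >= 0 is determined by the set
    of the k entries below its corner: the corner holds the least letter of the
    content, those k entries are any k of the other letters that occur, and the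
    remaining letters fill the first row in increasing order. Hence
    K_(theta, c) = binomial (p - 1, k), where p is the number of positive c_i
    ([kostka_hook]). For k = 0 this is 1: a one-row Kostka number only records
    whether c is nonnegative ([kostka_one_row]).

    Let i0 be the first row with nu_i < mu_i. No b_j equals a_(i0)
    ([first_row_content]), so c_(i0) > 0 whenever c >= 0, whatever w is. The
    binomial therefore counts, among the k-subsets S of [n] minus i0, those all of
    whose elements i satisfy c_i > 0; the S to choose from do not depend on w.
    For integers, c >= 0 and c > 0 on S together say exactly that
    2 c_i - [i in S] >= 0 for all i ([kostka_hook_cuts]).

    If nu_i < mu_i on S, then 2 a - 1_S and 2 b are again strictly decreasing,
    and they are the shifted rows of a skew shape alpha / beta ([cut_shape]), so
    that the w for which the inequalities hold are counted by a
    Stanley-Stembridge character ([cut_charE]). If mu_i = nu_i for some i in S,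
    then the inequalities would make w^-1 inject the rows from i on into the
    rows after i; no w satisfies them ([not_admissible_cut]). Summing over S
    writes the hook character as a sum of Stanley-Stembridge characters. *)

(** * Fillings of a hook *)

Lemma cell_inj (theta : seq nat) (x y : cell theta) :
  cell_row x = cell_row y -> cell_col x = cell_col y -> x = y.
Proof.
case: x => [[r hr] [j hj]]; case: y => [[r' hr'] [j' hj']].
rewrite /cell_row /cell_col /= => er ej; subst r' j'.
rewrite (bool_irrelevance hr' hr) in hj' *.
by rewrite (bool_irrelevance hj' hj).
Qed.

Definition mk_cell (theta : seq nat) (r j : nat) (hr : (r < size theta)%N)
    (hj : (j < part theta r)%N) : cell theta :=
  Tagged (fun r : 'I_(size theta) => 'I_(part theta r))
    (Ordinal hj : 'I_(part theta (Ordinal hr))).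

Lemma part_hook_leg (N k r : nat) :
  part (hook N k) r.+1 = (r < k)%N.
Proof. by rewrite /part /= nth_nseq; case: ltnP. Qed.

Lemma leg_row_proof (N k : nat) (r : 'I_k) : (r.+1 < size (hook N k))%N.
Proof. by rewrite /= size_nseq ltnS. Qed.

Lemma leg_col_proof (N k : nat) (r : 'I_k) : (0 < part (hook N k) r.+1)%N.
Proof. by rewrite part_hook_leg ltn_ord. Qed.

Definition arm_cell (N k : nat) (j : 'I_(N - k)) : cell (hook N k) :=
  @mk_cell (hook N k) 0 j (ltn0Sn _) (ltn_ord j).

Definition leg_cell (N k : nat) (r : 'I_k) : cell (hook N k) :=
  mk_cell (leg_row_proof N r) (leg_col_proof N r).

Lemma hook_cell_col_lt (N k : nat) (x : cell (hook N k)) :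
  cell_row x = 0%N -> (cell_col x < N - k)%N.
Proof.
case: x => [[r hr] [j hj]]; rewrite /cell_row /cell_col /= => er; subst r.
exact: hj.
Qed.

Lemma hook_cell_leg (N k : nat) (x : cell (hook N k)) :
  (0 < cell_row x)%N -> (cell_row x <= k)%N /\ cell_col x = 0%N.
Proof.
case: x => [[[|r] hr] [j hj]]; rewrite /cell_row /cell_col //= => _.
by move: (hj : (j < part (hook N k) r.+1)%N); rewrite part_hook_leg; lia.
Qed.

(** A statistic of the whole hook splits into one of its arm (the first row,
    corner included) and one of its leg (the column below the corner). *)
Lemma hook_cells (N k : nat) :
  perm_eq (enum (cell (hook N k)))
    ([seq arm_cell j | j <- enum 'I_(N - k)] ++
     [seq leg_cell N r | r <- enum 'I_k]).
Proof.
apply: uniq_perm; first exact: enum_uniq.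
- have uarm : uniq [seq @arm_cell N k j | j <- enum 'I_(N - k)].
    rewrite map_inj_uniq; first exact: enum_uniq.
    by move=> j j' ejj; apply/val_inj/(congr1 (@cell_col (hook N k)) ejj).
  have uleg : uniq [seq leg_cell N r | r <- enum 'I_k].
    rewrite map_inj_uniq; first exact: enum_uniq.
    move=> r r' err; apply/val_inj/succn_inj.
    exact: (congr1 (@cell_row (hook N k)) err).
  rewrite cat_uniq uarm uleg andbT /=.
  apply/hasPn => _ /mapP[r _ ->]; apply/negP => /mapP[j _ elj].
  by have := congr1 (@cell_row (hook N k)) elj.
move=> x; rewrite mem_enum inE mem_cat; apply/esym/orP.
case: (posnP (cell_row x)) => [r0|rpos].
- left; apply/mapP; exists (Ordinal (hook_cell_col_lt r0)).
    by rewrite mem_enum.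
  exact: cell_inj.
- have [rk c0] := hook_cell_leg rpos.
  have hr : ((cell_row x).-1 < k)%N by lia.
  right; apply/mapP; exists (Ordinal hr); first by rewrite mem_enum.
  apply: cell_inj; first by rewrite [RHS]/= /cell_row /= -/(cell_row x) prednK.
  by rewrite c0.
Qed.

Definition arm_word (n N k : nat) (t : {ffun cell (hook N k) -> 'I_n}) :=
  [seq t (arm_cell j) | j <- enum 'I_(N - k)].

Definition leg_word (n N k : nat) (t : {ffun cell (hook N k) -> 'I_n}) :=
  [seq t (leg_cell N r) | r <- enum 'I_k].

Lemma size_arm_word (n N k : nat) (t : {ffun cell (hook N k) -> 'I_n}) :
  size (arm_word t) = (N - k)%N.
Proof. by rewrite size_map size_enum_ord. Qed.

Lemma size_leg_word (n N k : nat) (t : {ffun cell (hook N k) -> 'I_n}) :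
  size (leg_word t) = k.
Proof. by rewrite size_map size_enum_ord. Qed.

Lemma arm_wordE (n N k : nat) (t : {ffun cell (hook N k) -> 'I_n}) i0 x :
  cell_row x = 0%N -> t x = nth i0 (arm_word t) (cell_col x).
Proof.
move=> r0; have lt := hook_cell_col_lt r0.
rewrite (nth_map (Ordinal lt)) ?size_enum_ord //; congr (t _).
apply: cell_inj => //; rewrite /cell_col /= -/(cell_col x).
by rewrite (nth_enum_ord (Ordinal lt)).
Qed.

(** The default value of [head] is never read: if the arm is empty, no cell lies
    in row 0. *)
Lemma column_wordE (n N k : nat) (t : {ffun cell (hook N k) -> 'I_n}) i0 x :
  cell_col x = 0%N ->
  t x = nth i0 (head i0 (arm_word t) :: leg_word t) (cell_row x).
Proof.
move=> c0; case: (posnP (cell_row x)) => [r0|rpos].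
  by rewrite (arm_wordE t i0 r0) c0 r0 nth0.
have [rk _] := hook_cell_leg rpos.
have hr : ((cell_row x).-1 < k)%N by lia.
rewrite -[in RHS](prednK rpos) /= (nth_map (Ordinal hr)) ?size_enum_ord //.
congr (t _); apply: cell_inj => //.
rewrite [in RHS]/cell_row /= (nth_enum_ord (Ordinal hr)) //.
by rewrite prednK.
Qed.

Lemma words_inj (n N k : nat) (t u : {ffun cell (hook N k) -> 'I_n}) :
  arm_word t = arm_word u -> leg_word t = leg_word u -> t = u.
Proof.
move=> ea el; apply/ffunP => x.
case: (posnP (cell_row x)) => [r0|rpos].
  by rewrite (arm_wordE t (t x) r0) (arm_wordE u (t x) r0) ea.
have [_ c0] := hook_cell_leg rpos.
by rewrite (column_wordE t (t x) c0) (column_wordE u (t x) c0) ea el.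
Qed.

Definition fill (n N k : nat) (i0 : 'I_n) (rs cs : seq 'I_n)
    : {ffun cell (hook N k) -> 'I_n} :=
  [ffun x => if cell_row x == 0%N then nth i0 rs (cell_col x)
             else nth i0 cs (cell_row x).-1].

Lemma arm_word_fill (n N k : nat) (i0 : 'I_n) rs cs :
  size rs = (N - k)%N -> arm_word (fill N k i0 rs cs) = rs.
Proof.
move=> sz; apply: (@eq_from_nth _ i0); rewrite size_arm_word ?sz // => j hj.
rewrite (nth_map (Ordinal hj)) ?size_enum_ord // ffunE /= /cell_col /=.
by rewrite (nth_enum_ord (Ordinal hj)).
Qed.

Lemma leg_word_fill (n N k : nat) (i0 : 'I_n) rs cs :
  size cs = k -> leg_word (fill N k i0 rs cs) = cs.
Proof.
move=> sz; apply: (@eq_from_nth _ i0); rewrite size_leg_word ?sz // => j hj.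
rewrite (nth_map (Ordinal hj)) ?size_enum_ord // ffunE /= /cell_row /=.
by rewrite (nth_enum_ord (Ordinal hj)).
Qed.

Lemma content_words (n N k : nat) (t : {ffun cell (hook N k) -> 'I_n}) i :
  #|[set x | t x == i]| = count_mem i (arm_word t ++ leg_word t).
Proof.
rewrite /arm_word /leg_word (map_comp t) (map_comp t (@leg_cell N k)).
rewrite -map_cat count_map -(seq.permP (hook_cells N k)) enumT.
by rewrite cardE /enum_mem size_filter; apply: eq_count => x; rewrite !inE.
Qed.

(** * Kostka numbers of hooks *)

Definition leo (n : nat) (i j : 'I_n) : bool := (i <= j)%N.
Definition lto (n : nat) (i j : 'I_n) : bool := (i < j)%N.

Lemma leo_trans (n : nat) : transitive (@leo n).
Proof. by move=> j i l; apply: leq_trans. Qed.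

Lemma leo_refl (n : nat) : reflexive (@leo n).
Proof. by move=> i; apply: leqnn. Qed.

Lemma leo_anti (n : nat) : antisymmetric (@leo n).
Proof. by move=> i j leij; apply/val_inj/anti_leq. Qed.

Lemma lto_trans (n : nat) : transitive (@lto n).
Proof. by move=> j i l; apply: ltn_trans. Qed.

Lemma lto_irr (n : nat) : irreflexive (@lto n).
Proof. by move=> i; apply: ltnn. Qed.

Lemma sorted_lto_enum_ord (n : nat) : sorted (@lto n) (enum 'I_n).
Proof.
by have := iota_ltn_sorted 0 n; rewrite -val_enum_ord sorted_map.
Qed.

Lemma sorted_lto_enum (n : nat) (S : {set 'I_n}) : sorted (@lto n) (enum S).
Proof.
rewrite /enum_mem; apply: sorted_filter; first exact: lto_trans.
by rewrite -enumT sorted_lto_enum_ord.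
Qed.

(** The rows below the first have one cell and the columns after the first have
    one cell, so only the first row and the first column impose conditions. The
    [path] starts at the corner, which belongs to the arm. *)
Lemma semistandard_hookE (n N k : nat) (t : {ffun cell (hook N k) -> 'I_n}) i0 :
  (k < N)%N ->
  semistandard t = sorted (@leo n) (arm_word t) &&
                   path (@lto n) (head i0 (arm_word t)) (leg_word t).
Proof.
move=> kN; apply/idP/andP => [/forallP ss|[arm_s leg_s]].
  have {}ss (x y : cell (hook N k)) := forallP (ss x) y.
  have row_ss (x y : cell (hook N k)) : cell_row x = cell_row y -> (cell_col x <= cell_col y)%N ->
      (t x <= t y)%N.
    by move=> er lc; case/andP: (ss x y) => /implyP H _; apply: H; rewrite er eqxx.
  have col_ss (x y : cell (hook N k)) : cell_col x = cell_col y -> (cell_row x < cell_row y)%N ->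
      (t x < t y)%N.
    by move=> ec lr; case/andP: (ss x y) => _ /implyP H; apply: H; rewrite ec eqxx.
  split.
    rewrite sorted_map; apply: (@sub_sorted _ (@lto _)) => [j l /= jl|].
      by apply: row_ss => //; apply: ltnW.
    exact: sorted_lto_enum_ord.
  have p0 : (0 < N - k)%N by rewrite subn_gt0.
  rewrite path_sortedE; last exact: lto_trans.
  apply/andP; split.
    have -> : head i0 (arm_word t) = t (arm_cell (Ordinal p0)).
      by rewrite (arm_wordE t i0 (erefl : cell_row (arm_cell _) = 0%N)) nth0.
    by apply/allP => _ /mapP[r _ ->]; apply: col_ss.
  rewrite sorted_map; apply: (@sub_sorted _ (@lto _)) => [j l /= jl|].
    by apply: col_ss.
  exact: sorted_lto_enum_ord.
apply/forallP => x; apply/forallP => y; apply/andP; split; apply/implyP.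
  case/andP => /eqP er lc; case: (posnP (cell_row x)) => [r0|rpos].
    have r0' : cell_row y = 0%N by rewrite -er.
    rewrite (arm_wordE t i0 r0) (arm_wordE t i0 r0').
    apply: (sorted_leq_nth (@leo_trans n) (@leo_refl n) i0 arm_s) => //;
      by rewrite inE size_arm_word; apply: hook_cell_col_lt.
  have [_ c0] := hook_cell_leg rpos.
  rewrite er in rpos; have [_ c0'] := hook_cell_leg rpos.
  by rewrite (@cell_inj _ x y) // c0 c0'.
case/andP => /eqP ec lr; have rpos : (0 < cell_row y)%N by lia.
have [rk c0'] := hook_cell_leg rpos.
have c0 : cell_col x = 0%N by rewrite ec.
rewrite (column_wordE t i0 c0) (column_wordE t i0 c0').
have col_s : sorted (@lto n) (head i0 (arm_word t) :: leg_word t) := leg_s.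
apply: (sorted_ltn_nth (@lto_trans n) i0 col_s) => //;
  by rewrite inE /= size_leg_word; lia.
Qed.

Definition content_word (n : nat) (d : 'I_n -> nat) : seq 'I_n :=
  sort (@leo n) (flatten [seq nseq (d i) i | i <- enum 'I_n]).

Lemma sorted_content_word (n : nat) (d : 'I_n -> nat) :
  sorted (@leo n) (content_word d).
Proof. by apply: sort_sorted => i j; apply: leq_total. Qed.

Lemma count_content_word (n : nat) (d : 'I_n -> nat) i :
  count_mem i (content_word d) = d i.
Proof.
rewrite (seq.permP (permEl (perm_sort _ _))) count_flatten -map_comp sumnE big_map.
rewrite big_enum /= (bigD1 i) //= count_nseq /= eqxx mul1n big1 ?addn0 // => j ji.
by rewrite count_nseq /= (negPf ji).
Qed.

Lemma size_content_word (n : nat) (d : 'I_n -> nat) :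
  size (content_word d) = (\sum_i d i)%N.
Proof.
rewrite size_sort size_flatten sumnE /shape -map_comp big_map big_enum /=.
by apply: eq_bigr => i _; rewrite size_nseq.
Qed.

Lemma content_word_uniq (n : nat) (s : seq 'I_n) (d : 'I_n -> nat) :
  sorted (@leo n) s -> (forall i, count_mem i s = d i) -> s = content_word d.
Proof.
move=> s_s cs; apply: (sorted_eq (@leo_trans n) (@leo_anti n)) => //.
  exact: sorted_content_word.
by apply/allP => i _; apply/eqP; rewrite /= cs count_content_word.
Qed.

Lemma sorted_lto_set (n : nat) (s : seq 'I_n) :
  sorted (@lto n) s -> enum [set i in s] = s.
Proof.
move=> s_s; apply: (irr_sorted_eq (@lto_trans n) (@lto_irr n)) => //.
  exact: sorted_lto_enum.
by move=> i; rewrite mem_enum inE.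
Qed.

(** Bijection between the tableaux and the k-sets of letters of positive content
    other than the least such letter: [Psi] reads the set of entries of the leg,
    and [Phi] puts a given set in the leg and sorts the letters that are left
    into the arm. The least letter cannot be in the leg since the corner is
    strictly smaller; conversely, leaving it to the arm forces it into the
    corner, and then the first column is strictly increasing. *)
Lemma kostka_hook_nat (n N k : nat) (c : 'I_n -> nat) :
  (\sum_i c i)%N = N -> (k < N)%N ->
  kostka (hook N k) (fun i => Posz (c i)) = 'C(#|[set i | 0 < c i]%N|.-1, k).
Proof.
move=> sumc kN; set P := [set i | _].
have [p pP] : exists p, p \in P.
  apply/set0Pn; apply/negP => /eqP P0; move: kN; rewrite -sumc big1 // => i _.
  by have := in_set0 i; rewrite -P0 inE; lia.
have [x0 x0P x0min] : exists2 x0, x0 \in P & forall i, i \in P -> (x0 <= i)%N.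
  by case: (@arg_minnP _ p (mem P) val pP) => x0; exists x0.
have -> : #|P|.-1 = #|P :\ x0| by rewrite (cardsD1 x0 P) x0P.
rewrite -cards_draws /kostka; set B := [set S : {set 'I_n} | _].
set A := [set T | _].
pose rest (S : {set 'I_n}) i := (c i - (i \in S))%N.
pose Phi (S : {set 'I_n}) := fill N k x0 (content_word (rest S)) (enum S).
pose Psi (t : {ffun cell (hook N k) -> 'I_n}) := [set i in leg_word t].
have Bc (S : {set 'I_n}) i : S \in B -> (i \in S <= c i)%N.
  rewrite inE => /andP[/subsetP sSP _]; case: (boolP (i \in S)) => // /sSP.
  by rewrite !inE => /andP[].
have armPhi S : S \in B -> arm_word (Phi S) = content_word (rest S).
  move=> SB; apply: arm_word_fill; rewrite size_content_word.
  rewrite sumnB; last by move=> i _; apply: Bc.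
  rewrite sumc; congr (_ - _)%N.
  by move: SB; rewrite inE => /andP[_ /eqP <-]; rewrite -sum1_card [RHS]big_mkcond;
    apply: eq_bigr => i _; case: (i \in S).
have legPhi S : S \in B -> leg_word (Phi S) = enum S.
  move=> SB; apply: leg_word_fill; rewrite -cardE.
  by move: SB; rewrite inE => /andP[_ /eqP].
have memA t : (t \in A) =
    [&& sorted (@leo n) (arm_word t), path (@lto n) (head x0 (arm_word t)) (leg_word t)
      & [forall i, count_mem i (arm_word t ++ leg_word t) == c i]].
  rewrite inE (semistandard_hookE t x0 kN) -andbA; congr [&& _, _ & _].
  by apply: eq_forallb => i; rewrite content_words eqz_nat.
have PsiPhi : {in B, cancel Phi Psi}.
  by move=> S SB; apply/setP => i; rewrite inE legPhi // mem_enum.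
have PhiA S : S \in B -> Phi S \in A.
  move=> SB; rewrite memA armPhi // legPhi // sorted_content_word /=.
  apply/andP; split.
    rewrite path_sortedE; last exact: lto_trans.
    rewrite sorted_lto_enum andbT; apply/allP => i; rewrite mem_enum => iS.
    have [x0S iP ix0] : [/\ x0 \notin S, i \in P & i != x0].
      move: SB; rewrite inE => /andP[/subsetP sSP _]; split.
      - by apply/negP => /sSP; rewrite !inE eqxx.
      - by move/sSP: iS => /setD1P[].
      - by move/sSP: iS => /setD1P[].
    have x0w : x0 \in content_word (rest S).
      rewrite -has_pred1 has_count count_content_word /rest (negPf x0S) subn0.
      by move: x0P; rewrite inE.
    (* As x0 is in the sorted arm, the corner is at most x0. *)
    have hx0 : (head x0 (content_word (rest S)) <= x0)%N.
      have := sorted_content_word (rest S).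
      case: (content_word _) x0w => // h w; rewrite inE => /predU1P[->|x0w] //=.
      by rewrite (path_sortedE (@leo_trans n)) => /andP[/allP/(_ _ x0w)].
    apply: leq_ltn_trans hx0 _; rewrite ltn_neqAle eq_sym -val_eqE in ix0 *.
    by rewrite ix0 /=; apply: x0min.
  apply/forallP => i; rewrite count_cat count_content_word.
  by rewrite count_uniq_mem ?enum_uniq // mem_enum subnK // Bc.
have PsiB t : t \in A -> Psi t \in B /\ Phi (Psi t) = t.
  rewrite memA => /and3P[arm_s leg_p /forallP cnt].
  have leg_s := path_sorted leg_p.
  have leg_u : uniq (leg_word t) := sorted_uniq (@lto_trans n) (@lto_irr n) leg_s.
  have enumPsi : enum (Psi t) = leg_word t by apply: sorted_lto_set.
  have cleg i : (count_mem i (leg_word t) = (i \in Psi t))%N.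
    by rewrite count_uniq_mem // inE.
  have {}cnt i : (count_mem i (arm_word t) + (i \in Psi t) = c i)%N.
    by rewrite -cleg -count_cat; apply/eqP.
  have tB : Psi t \in B.
    rewrite inE cardE enumPsi size_leg_word eqxx andbT.
    apply/subsetP => i iPsi; rewrite !inE -(cnt i) iPsi addn1 andbT.
    have hP : head x0 (arm_word t) \in P.
      rewrite inE -cnt addn_gt0 -has_count has_pred1.
      have : (0 < size (arm_word t))%N by rewrite size_arm_word subn_gt0.
      by case: (arm_word t) => // h w _; rewrite mem_head.
    move: leg_p; rewrite (path_sortedE (@lto_trans n)) => /andP[/allP lt _].
    have {}lt : (head x0 (arm_word t) < i)%N by apply: lt; move: iPsi; rewrite inE.
    by apply: contraTneq lt => ->; rewrite -leqNgt x0min.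
  split=> //; apply: words_inj; last by rewrite legPhi.
  by rewrite armPhi //; apply/esym/content_word_uniq => // i; rewrite /rest -cnt addnK.
have -> : A = Phi @: B.
  apply/setP => t; apply/idP/imsetP => [/PsiB[PB PhiPsi]|[S SB ->]].
    by exists (Psi t).
  exact: PhiA.
by rewrite card_in_imset //; apply: can_in_inj PsiPhi.
Qed.

Lemma kostka_neg (n : nat) (theta : seq nat) (c : 'I_n -> int) :
  ~~ [forall i, 0 <= c i] -> kostka theta c = 0%N.
Proof.
case/forallPn => i ci; apply/eqP; rewrite cards_eq0 -subset0.
apply/subsetP => t; rewrite !inE => /andP[_ /forallP/(_ i)/eqP ti].
by rewrite -ti in ci.
Qed.

Lemma kostka_hook (n N k : nat) (c : 'I_n -> int) :
  \sum_i c i = Posz N -> (k < N)%N ->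
  kostka (hook N k) c =
    if [forall i, 0 <= c i] then 'C(#|[set i | 0 < c i]|.-1, k) else 0%N.
Proof.
move=> sumc kN; case: ifPn => [/forallP c0|]; last exact: kostka_neg.
pose d i := `|c i|%N.
have cd i : c i = Posz (d i) by have := c0 i; rewrite /d; lia.
have -> : kostka (hook N k) c = kostka (hook N k) (fun i => Posz (d i)).
  rewrite /kostka; congr #|pred_of_set _|; apply/setP => t; rewrite !inE.
  by congr (_ && _); apply: eq_forallb => i; rewrite -cd.
rewrite (kostka_hook_nat (c := d) (N := N)) //.
  by congr 'C(_.-1, _); apply: eq_card => i; rewrite !inE cd.
apply/eqP; rewrite -eqz_nat -sumc; apply/eqP.
by rewrite (big_morph Posz PoszD erefl); apply: eq_bigr => i _; rewrite -cd.
Qed.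

Lemma kostka_one_row (n M : nat) (c : 'I_n -> int) :
  \sum_i c i = Posz M -> (0 < M)%N ->
  kostka (one_row M) c = [forall i, 0 <= c i].
Proof.
move=> sumc M0; have := kostka_hook sumc M0; rewrite /hook subn0 /= => ->.
by rewrite bin0; case: ifP.
Qed.

(** * Contents attached to a skew shape *)

Lemma part_noninc (p : seq nat) (i j : nat) :
  is_partition p -> (i <= j)%N -> (part p j <= part p i)%N.
Proof.
case/andP => p_s _ ij; rewrite /part.
have [pj|jp] := leqP (size p) j; first by rewrite nth_default.
have geq_trans : transitive geq by move=> a b c; rewrite /geq /= => ba ca; lia.
have geq_refl : reflexive geq by move=> a; rewrite /geq /=.
by apply: (sorted_leq_nth geq_trans geq_refl 0 p_s); rewrite ?inE //; lia.
Qed.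

(** This is what makes the first n rows determine the size of the shape and the
    sum of the contents, even when both partitions have more than n parts. *)
Lemma part_beyond_length (n : nat) (mu nu : seq nat) (i : nat) :
  is_skew_shape mu nu -> (skew_length mu nu <= n)%N -> (n <= i)%N ->
  part mu i = part nu i.
Proof.
case=> _ _ sub len ni; have := sub i; rewrite leq_eqVlt => /predU1P[//|lt].
have iszm : (i < size mu)%N.
  by rewrite ltnNge; apply: contraL lt => sz; rewrite /part [X in (_ < X)%N]nth_default.
move/bigmax_leqP: len => /(_ (Ordinal iszm) lt) /=; lia.
Qed.

Lemma skew_sizeE (n : nat) (mu nu : seq nat) :
  is_skew_shape mu nu -> (skew_length mu nu <= n)%N ->
  skew_size mu nu = (\sum_(i < n) (part mu i - part nu i))%N.
Proof.
move=> shape len; pose f i := (part mu i - part nu i)%N.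
have fz m : (forall i, (m <= i)%N -> f i = 0%N) ->
    (\sum_(i < m) f i = \sum_(i < size mu + n) f i)%N \/ (size mu + n < m)%N.
  move=> fm; have [le|lt] := leqP m (size mu + n); last by right.
  left; rewrite -!(big_mkord xpredT f) (big_cat_nat (leq0n m) le) //= [X in (_ + X)%N]big_nat.
  by rewrite [X in (_ + X)%N]big1 ?addn0 // => i /andP[/fm].
rewrite /skew_size; have [|->|] := fz (size mu); last by lia.
  by move=> i szi; rewrite /f /part nth_default.
have [|->|] := fz n; [|by []|by lia].
by move=> i ni; rewrite /f (part_beyond_length shape len ni) subnn.
Qed.

(** Permuting the entries of nu + delta does not change their sum, and delta
    cancels. *)
Lemma sum_content (n : nat) (mu nu : seq nat) (w : 'S_n) :
  is_skew_shape mu nu -> (skew_length mu nu <= n)%N ->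
  \sum_i (shifted mu i - seq_act w (shifted nu) i) = Posz (skew_size mu nu).
Proof.
move=> shape len; rewrite (skew_sizeE shape len) sumrB.
have -> : \sum_i seq_act w (shifted nu) i = \sum_(i < n) shifted nu i.
  by rewrite [RHS](reindex_perm (w^-1)%g).
rewrite -sumrB.
rewrite (big_morph Posz PoszD erefl); apply: eq_bigr => i _.
by case: shape => _ _ /(_ i); rewrite /shifted; lia.
Qed.

Lemma shifted_decreasing (n : nat) (p : seq nat) (i j : 'I_n) :
  is_partition p -> (i < j)%N -> shifted p j < shifted p i :> int.
Proof.
move=> pp ij; have := part_noninc pp (ltnW ij); rewrite /shifted.
by have := ltn_ord j; lia.
Qed.

(** * Partitions with prescribed first rows *)

(** Deleting zeros turns a weakly decreasing list of rows into a partition with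
    the same rows. *)
Definition partition_of (n : nat) (f : 'I_n -> nat) : seq nat :=
  [seq x <- [seq f i | i <- enum 'I_n] | (0 < x)%N].

Lemma nth_filter_pos (s : seq nat) (i : nat) :
  sorted geq s -> nth 0%N [seq x <- s | (0 < x)%N] i = nth 0%N s i.
Proof.
elim: s i => [|x s IHs] i //= xs; have {}IHs := IHs _ (path_sorted xs).
case: (posnP x) => [x0|_]; last by case: i => [|i] /=.
have s0 y : y \in s -> y = 0%N.
  move: xs; rewrite path_sortedE; last by move=> a b c; rewrite /geq /=; lia.
  by case/andP => /allP H _ /H; rewrite /geq /=; lia.
rewrite IHs; case: i => [|i] /=.
  by rewrite x0; move: s0; clear; case: s => //= y s2 s20; rewrite (s20 y) ?mem_head.
have nths j : nth 0%N s j = 0%N.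
  have [sj|js] := leqP (size s) j; first by rewrite nth_default.
  exact/s0/mem_nth.
by rewrite !nths.
Qed.

Lemma sorted_rows (n : nat) (f : 'I_n -> nat) :
  (forall i j : 'I_n, (i < j)%N -> (f j <= f i)%N) ->
  sorted geq [seq f i | i <- enum 'I_n].
Proof.
move=> f_ni; rewrite sorted_map.
by apply: sub_sorted (sorted_lto_enum_ord n) => i j; apply: f_ni.
Qed.

Lemma is_partition_of (n : nat) (f : 'I_n -> nat) :
  (forall i j : 'I_n, (i < j)%N -> (f j <= f i)%N) ->
  is_partition (partition_of f).
Proof.
move=> f_ni; rewrite /is_partition mem_filter andbT sorted_filter ?sorted_rows //.
by move=> a b c; rewrite /geq /=; lia.
Qed.

Lemma part_of_ord (n : nat) (f : 'I_n -> nat) (i : 'I_n) :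
  (forall i j : 'I_n, (i < j)%N -> (f j <= f i)%N) ->
  part (partition_of f) i = f i.
Proof.
move=> f_ni; rewrite /part nth_filter_pos ?sorted_rows //.
by rewrite (nth_map i) ?size_enum_ord // nth_ord_enum.
Qed.

Lemma part_of_beyond (n : nat) (f : 'I_n -> nat) (i : nat) :
  (n <= i)%N -> part (partition_of f) i = 0%N.
Proof.
move=> ni; rewrite /part nth_default // size_filter (leq_trans (count_size _ _)) //.
by rewrite size_map size_enum_ord.
Qed.

(** * Cutting corners off the shifted shape *)

(** The rows of the shape whose shifted rows are 2 (mu + delta) - 1_S and
    2 (nu + delta): subtracting delta once from 2 (mu_i + delta_i) - [i in S]
    leaves 2 mu_i + delta_i - [i in S]. *)
Definition outer_rows (n : nat) (mu : seq nat) (S : {set 'I_n}) (i : 'I_n) : nat :=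
  (2 * part mu i + (n - i.+1) - (i \in S))%N.

Definition inner_rows (n : nat) (nu : seq nat) (i : 'I_n) : nat :=
  (2 * part nu i + (n - i.+1))%N.

Definition admissible (n : nat) (mu nu : seq nat) (S : {set 'I_n}) : bool :=
  [forall (i | i \in S), part nu i < part mu i]%N.

(** Doubling delta leaves a difference of at least 1 between consecutive rows,
    which absorbs the subtraction of 1_S. *)
Lemma outer_rows_noninc (n : nat) (mu : seq nat) (S : {set 'I_n}) (i j : 'I_n) :
  is_partition mu -> (i < j)%N -> (outer_rows mu S j <= outer_rows mu S i)%N.
Proof.
move=> pmu ij; have := part_noninc pmu (ltnW ij); have := ltn_ord j.
by rewrite /outer_rows; lia.
Qed.

Lemma inner_rows_noninc (n : nat) (nu : seq nat) (i j : 'I_n) :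
  is_partition nu -> (i < j)%N -> (inner_rows nu j <= inner_rows nu i)%N.
Proof.
move=> pnu ij; have := part_noninc pnu (ltnW ij); have := ltn_ord j.
by rewrite /inner_rows; lia.
Qed.

Lemma cut_shape (n : nat) (mu nu : seq nat) (S : {set 'I_n}) :
  is_skew_shape mu nu -> admissible mu nu S ->
  let alpha := partition_of (outer_rows mu S) in
  let beta := partition_of (inner_rows (n := n) nu) in
  [/\ is_skew_shape alpha beta, (skew_length alpha beta <= n)%N,
      forall i : 'I_n, shifted alpha i = 2%:Z * shifted mu i - Posz (i \in S)
    & forall i : 'I_n, shifted beta i = 2%:Z * shifted nu i].
Proof.
case=> pmu pnu sub /forall_inP adm alpha beta.
have out_ni (i j : 'I_n) := @outer_rows_noninc n mu S i j pmu.
have in_ni (i j : 'I_n) := @inner_rows_noninc n nu i j pnu.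
have alphaE (i : 'I_n) : part alpha i = outer_rows mu S i by apply: part_of_ord.
have betaE (i : 'I_n) : part beta i = inner_rows nu i by apply: part_of_ord.
have admS (i : 'I_n) : (part nu i + (i \in S) <= part mu i)%N.
  case: (boolP (i \in S)) => [/adm|_]; last by rewrite addn0.
  by rewrite addn1.
split.
- split; [exact: is_partition_of|exact: is_partition_of|] => i.
  have [ni|lt] := leqP n i; first by rewrite !part_of_beyond.
  rewrite (alphaE (Ordinal lt)) (betaE (Ordinal lt)) /outer_rows /inner_rows.
  by move: (Ordinal lt) => j; have := admS j; case: (j \in S) => /=; lia.
- apply/bigmax_leqP => i lt; rewrite ltnNge; apply: contraL lt => ni.
  by rewrite !part_of_beyond.
- move=> i; rewrite /shifted alphaE /outer_rows.
  by have := admS i; case: (i \in S) => /=; lia.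
- by move=> i; rewrite /shifted betaE /inner_rows; lia.
Qed.

Lemma sum_cut (n k : nat) (c : 'I_n -> int) (S : {set 'I_n}) :
  #|S| = k ->
  \sum_i (2%:Z * c i - Posz (i \in S)) = 2%:Z * (\sum_i c i) - Posz k.
Proof.
move=> <-; rewrite sumrB -mulr_sumr; congr (_ - _).
rewrite -sum1_card [in RHS]big_mkcond (big_morph Posz PoszD erefl).
by apply: eq_bigr => i _; case: (i \in S).
Qed.

(** As c is integral, this means c >= 0 together with c_i > 0 for i in S. *)
Definition cut_nonneg (n : nat) (c : 'I_n -> int) (S : {set 'I_n}) : bool :=
  [forall i, 0 <= 2%:Z * c i - Posz (i \in S)].

(** The row i0 serves as a marked element of the set P of the rows of positive
    content: binomial (#|P| - 1, k) is the number of k-subsets of P that avoid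
    i0, for any i0 in P. A marking that is the same for all contents makes the
    index set of the sum independent of c. *)
Lemma kostka_hook_cuts (n N k : nat) (c : 'I_n -> int) (i0 : 'I_n) :
  \sum_i c i = Posz N -> (k < N)%N -> c i0 != 0 ->
  kostka (hook N k) c =
    (\sum_(S : {set 'I_n} | (S \subset ~: [set i0]) && (#|S| == k))
      cut_nonneg c S)%N.
Proof.
move=> sumc kN ci0; rewrite (kostka_hook sumc kN); case: ifP => [/forallP c0|cneg].
  set P := [set i | _]; have i0P : i0 \in P by have := c0 i0; rewrite inE; lia.
  have -> : #|P|.-1 = #|P :\ i0| by rewrite (cardsD1 i0 P) i0P.
  rewrite -cards_draws -sum1_card [in RHS]big_mkcond [LHS]big_mkcond /=.
  apply: eq_bigr => S _; rewrite inE subsetD1 subsetC sub1set inE.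
  case: (#|S| == k); rewrite ?andbF // !andbT.
  case: (i0 \in S); rewrite ?andbF //= andbT.
  have -> : (S \subset P) = cut_nonneg c S.
    apply/subsetP/forallP => [SP i|Sc i iS].
      have := c0 i; case: (boolP (i \in S)) => [/SP|_] /=; first rewrite inE; lia.
    by have := Sc i; rewrite iS inE /=; lia.
  by case: (cut_nonneg c S).
rewrite big1 // => S _; apply/eqP; rewrite eqb0; apply/negP => /forallP Sc.
by move/negP: cneg; apply; apply/forallP => i; have := Sc i; lia.
Qed.

(** Take i0 to be the first row with nu_i < mu_i. For j < i0, b_j = a_j > a_(i0)
    as these rows are empty; for j >= i0, b_j <= b_(i0) < a_(i0). *)
Lemma first_row_content (n : nat) (mu nu : seq nat) :
  is_skew_shape mu nu -> (skew_length mu nu <= n)%N -> (0 < skew_size mu nu)%N ->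
  exists i0 : 'I_n, forall w : 'S_n,
    shifted mu i0 - seq_act w (shifted nu) i0 != 0.
Proof.
move=> shape len; rewrite (skew_sizeE shape len) => pos.
have [p lt_p] : exists p : 'I_n, (part nu p < part mu p)%N.
  apply/existsP; apply: contraTT pos => /existsPn none.
  rewrite big1 // => i _; have := none i; lia.
pose Q := [pred i : 'I_n | (part nu i < part mu i)%N].
case: (@arg_minnP _ p Q val lt_p) => i0 /= lt0 min0.
case: shape => pmu pnu sub; exists i0 => w; rewrite /seq_act subr_eq0.
set j := (w^-1)%g i0; apply/eqP => eab.
have [ji|ij|/val_inj eij] := ltngtP j i0.
- have eqj : part nu j = part mu j.
    apply/eqP; rewrite eqn_leq sub /= leqNgt; apply/negP => /min0; lia.
  have := shifted_decreasing pmu ji; rewrite /shifted in eab *; lia.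
- have := shifted_decreasing pnu ij; rewrite /shifted in eab *; lia.
- by rewrite /shifted -/j eij in eab; lia.
Qed.

(** Let i in S be an empty row, so a_i = b_i. For l >= i, the inequality in row l
    forces w^-1 l > i: if w^-1 l <= i, then b_(w^-1 l) >= b_i = a_i >= a_l, where
    either the last inequality is strict, or l = i and row i demands a strictly
    positive content. So w^-1 would inject {l | l >= i} into {l | l > i}. *)
Lemma not_admissible_cut (n : nat) (mu nu : seq nat) (S : {set 'I_n}) (w : 'S_n) :
  is_skew_shape mu nu -> ~~ admissible mu nu S ->
  cut_nonneg (fun i => shifted mu i - seq_act w (shifted nu) i) S = false.
Proof.
case=> pmu pnu sub; rewrite negb_forall => /existsP[i].
rewrite negb_imply -leqNgt => /andP[iS le_i]; apply/negP => /forallP cut.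
pose U := [set l : 'I_n | (i <= l)%N].
have /subset_leq_card : (w^-1)%g @: U \subset U :\ i.
  apply/subsetP => _ /imsetP[l lU ->]; rewrite inE in lU.
  have := cut l; rewrite /seq_act !inE; set j := (w^-1)%g l => cut_l.
  have [ji|ij|/val_inj eij] := ltngtP j i.
  - have := shifted_decreasing pnu ji; have := part_noninc pmu lU.
    by move: cut_l; rewrite /shifted; lia.
  - by rewrite andbT; apply: contraTneq ij => ->; rewrite ltnn.
  - move: cut_l; rewrite eij; have := part_noninc pmu lU.
    case: (eqVneq l i) => [->|nli]; first by rewrite iS /shifted; lia.
    have li : (i < l)%N by rewrite ltn_neqAle lU andbT eq_sym.
    by have := shifted_decreasing pmu li; rewrite /shifted; lia.
rewrite card_imset; last exact: perm_inj.
by rewrite (cardsD1 i U) inE leqnn ltnn.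
Qed.

(** * The decomposition *)

Definition cut_char (n : nat) (mu nu : seq nat) (S : {set 'I_n})
    : {ffun 'S_n -> int} :=
  let alpha := partition_of (outer_rows mu S) in
  let beta := partition_of (inner_rows (n := n) nu) in
  immanant_char n (one_row (skew_size alpha beta)) alpha beta.

Lemma cut_charE (n : nat) (mu nu : seq nat) (S : {set 'I_n}) (w : 'S_n) :
  is_skew_shape mu nu -> (skew_length mu nu <= n)%N ->
  (#|S| < skew_size mu nu)%N -> admissible mu nu S ->
  cut_char mu nu S w =
    Posz (n`! %/ #|(w ^: [set: 'S_n])%g|)%N *
    \sum_(w' in (w ^: [set: 'S_n])%g)
      Posz (cut_nonneg (fun i => shifted mu i - seq_act w' (shifted nu) i) S).
Proof.
move=> shape len kN adm; rewrite /cut_char.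
have [shape' len' alphaE betaE] := cut_shape shape adm.
set alpha := partition_of _ in shape' len' alphaE *.
set beta := partition_of _ in shape' len' betaE *.
rewrite ffunE; congr (_ * _); apply: eq_bigr => w' _; congr Posz.
have sumM := sum_content w' shape' len'.
have cE i : shifted alpha i - seq_act w' (shifted beta) i =
    2%:Z * (shifted mu i - seq_act w' (shifted nu) i) - Posz (i \in S).
  by rewrite alphaE /seq_act betaE; lia.
have M0 : (0 < skew_size alpha beta)%N.
  move: sumM; rewrite (eq_bigr _ (fun i _ => cE i)).
  by rewrite (sum_cut _ erefl) sum_content //; lia.
rewrite (kostka_one_row sumM M0); congr nat_of_bool.
by apply: eq_forallb => i; rewrite cE.
Qed.

Theorem theoremA (n N k : nat) (mu nu : seq nat)
  (hshape : is_skew_shape mu nu)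
  (hsize : skew_size mu nu = N)
  (hn : (skew_length mu nu <= n)%N)
  (hk : (k < N)%N) :
  exists s : seq (nat * {ffun 'S_n -> int}),
    (forall p, p \in s -> Stanley_Stembridge_char p.2) /\
    immanant_char n (hook N k) mu nu = \sum_(p <- s) p.2 *+ p.1.
Proof.
have [i0 c_i0] : exists i0 : 'I_n, forall w : 'S_n,
    shifted mu i0 - seq_act w (shifted nu) i0 != 0.
  by apply: first_row_content => //; rewrite hsize; lia.
pose D := [set S : {set 'I_n} | (S \subset ~: [set i0]) && (#|S| == k)].
exists [seq (1%N, cut_char mu nu T) | T : {set 'I_n} <- enum [set S in D | admissible mu nu S]].
split=> [p /mapP[S]|].
  rewrite mem_enum inE => /andP[_ adm] ->.
  have [shape' len' _ _] := cut_shape hshape adm.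
  by exists (partition_of (outer_rows mu S)), (partition_of (inner_rows (n := n) nu)).
apply/ffunP => w; rewrite big_map big_enum sum_ffunE ffunE /=.
under [RHS]eq_bigr => S.
  rewrite !inE => /andP[/andP[_ /eqP Sk] adm].
  rewrite mulr1n cut_charE ?Sk ?hsize //; over.
rewrite -mulr_sumr exchange_big /=; congr (_ * _); apply: eq_bigr => w' _.
rewrite (kostka_hook_cuts _ hk (c_i0 w')) ?sum_content ?hsize //.
rewrite (big_morph Posz PoszD erefl) (bigID (admissible mu nu)) /=.
(* The subsets that do not give a skew shape contribute nothing. *)
rewrite [X in _ + X]big1 ?addr0 => [|S /andP[_ nadm]].
  by apply: eq_bigl => S; rewrite !inE.
by rewrite not_admissible_cut.
Qed.
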